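(* Let $W$ be a tournament kernel on a probability space $(\mathcal S,\mu)$. Let $(\mathcal S_i)_{i\in\mathcal Q}$ ($\mathcal Q$ countable, possibly empty) be the atoms of $(\mathcal S,\sigma(\mathcal Z),\mu)$ and $\mathcal I=\mathcal S\setminus\bigcup_i\mathcal S_i$ its non-atomic part (possibly empty), and let $\eta$ be the map defined in the context. Then $\mathcal S=\mathcal I\sqcup\bigsqcup_{i\in\mathcal Q}\mathcal S_i$, $$\mu=\Big(1-\sum_{i\in\mathcal Q}\mu(\mathcal S_i)\Big)\mu_{\mathcal I}+\sum_{i\in\mathcal Q}\mu(\mathcal S_i)\mu_i,$$ and $W=\left(\bigoplus_{i\in\mathcal Q}\mu(\mathcal S_i)W_i,\mathcal I,\eta\right)$ (equality $\mu\times\mu$-a.e.), where the following hold (with the obvious modifications if $\mathcal Q$ or $\mathcal I$ is empty): (i) $\mu(\mathcal S_i)>0$ for each $i\in\mathcal Q$; (ii) $\mu_i(A)=\mu(A\cap\mathcal S_i)/\mu(\mathcal S_i)$ for measurable $A$; (iii) $\mu_{\mathcal I}$ is the probability measure induced by $\mu$ on $\mathcal I$, and it is non-atomic; (iv) $\eta|_{\mathcal Q}$ is injective, and $\eta|_{\mathcal I}$ is injective up to null sets and supported on $[0,1]\setminus\bigcup_{i\in\mathcal Q}[\eta(i),\eta(i)+\mu(\mathcal S_i))$; (v) for $i\in\mathcal Q$, $W_i=W|_{\mathcal S_i}$ on $(\mathcal S_i,\mu_i)$ is an irreducible tournament kernel; (vi) for every measurable $A\subseteq\mathcal I$ with $\mu_{\mathcal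 I}(A)>0$, the restriction $W|_A$ on $(A,\mu_{\mathcal I}(\cdot)/\mu_{\mathcal I}(A))$ is transitive.
   Context: A tournament kernel on a probability space $(\mathcal S,\mu)$ is a measurable $W:\mathcal S^2\to[0,1]$ with $W(x,y)+W(y,x)=1$ for $\mu\times\mu$-a.e. $(x,y)$. For measurable $A,B\subseteq\mathcal S$ with $\mu(A\cap B)=0$, write $A\prec B$ if $W(x,y)=1$ for a.e. $(x,y)\in A\times B$. $W$ is irreducible if there is no measurable $B$ with $0<\mu(B)<1$ and $B\prec\mathcal S\setminus B$. $W$ is transitive if $W(x,y)>0$ and $W(y,z)>0$ imply $W(x,z)=1$ for $\mu^3$-a.e. $(x,y,z)$. $\mathcal Z$ is the family of measurable $A\subseteq\mathcal S$ for which there is a partition $\{B,C\}$ of $\mathcal S\setminus A$ into measurable (possibly empty) sets with $B\prec A$, $A\prec C$, $B\prec C$; $\sigma(\mathcal Z)$ is the generated $\sigma$-algebra. An atom is $A\in\sigma(\mathcal Z)$ with $\mu(A)>0$ and no $A'\in\sigma(\mathcal Z)$, $A'\subseteq A$, with $0<\mu(A')<\mu(A)$; there are countably many atoms (up to null sets), indexed by $\mathcal Q$. Construction of $\eta$: write $\alpha_j=\mu(\mathcal S_j)$. For $x\in\mathcal S$ let $R_x=\{j\in\mathcal Q: W(x,y)=1\text{ for }\mu\text{-a.e. }y\in\mathcal S_j\}$ and $\Lambda(x)=\int_{\mathcal I}W(x,y)\,d\mu(y)+\sum_{j\in R_x}\alpha_j$. Define $\eta:\mathcal Q\cup\mathcal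 I\to[0,1]$ by $\eta(x)=1-\Lambda(x)$ for $x\in\mathcal I$ and $\eta(i)=1-\frac1{\mu(\mathcal S_i)}\int_{\mathcal S_i}\Lambda\,d\mu-\mu(\mathcal S_i)$ for $i\in\mathcal Q$. Direct sum of kernels $\left(\bigoplus_{i\in\mathcal Q}\alpha_iW_i,\mathcal I,\eta\right)$, for a countable $\mathcal Q$, a non-atomic probability space $(\mathcal I,\mu_{\mathcal I})$, $\alpha_i\ge0$ with $\sum\alpha_i\le1$, tournament kernels $W_i$ on $(\mathcal S_i,\mu_i)$ and $\eta:\mathcal Q\cup\mathcal I\to[0,1]$ with $\eta|_{\mathcal Q}$ injective and $\eta|_{\mathcal I}$ injective up to null sets: it is the kernel on $\mathcal I\sqcup\bigsqcup_i\mathcal S_i$ with measure $\sum_i\alpha_i\mu_i+(1-\sum_i\alpha_i)\mu_{\mathcal I}$, given by $W(x,y)=W_i(x,y)$ if $x,y\in\mathcal S_i$, $W(x,y)=1$ if $\eta(x)<\eta(y)$, $W(x,y)=0$ if $\eta(x)>\eta(y)$, where $\eta(x):=\eta(i)$ for $x\in\mathcal S_i$. *)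

(* Defs.v *)
From mathcomp Require Export all_boot all_order all_algebra.
From mathcomp Require Export all_classical all_reals all_analysis.
Export Order.TTheory GRing.Theory Num.Theory.
Export numFieldNormedType.Exports.

#[export] Set Implicit Arguments.
#[export] Unset Strict Implicit.
#[export] Unset Printing Implicit Defensive.

Local Open Scope classical_set_scope.
Local Open Scope ring_scope.
Local Open Scope ereal_scope.

(* The probability space (D, nu), for a measurable part D of T, is represented
   by D and a probability nu on T with nu D = 1; a kernel on it is a function
   on T whose values are only looked at on D * D.  The whole space is
   D = setT. *)

Section conditioning.
Context {d : measure_display} {T : measurableType d} {R : realType}.

(* B |-> P (B `&` A) / P A, for A measurable with P A > 0; it is P otherwise. *)
Definition cond_prob (P : probability T R) (A : set T) : probability T R :=
  match pselect (measurable A) with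
  | left mA => mnormalize (mrestr P mA) P
  | right _ => P
  end.

End conditioning.

Section kernels.
Context {d : measure_display} {T : measurableType d} {R : realType}.
Implicit Types (D A B C : set T) (nu : probability T R) (W : T -> T -> R).

Definition tournament_kernel D nu W :=
  [/\ measurable_fun (D `*` D) (fun p : T * T => W p.1 p.2),
      forall x y, D x -> D y -> (0 <= W x y <= 1)%R &
      {ae nu \x nu, forall p : T * T, D p.1 -> D p.2 ->
         (W p.1 p.2 + W p.2 p.1 = 1)%R}].

Definition prec nu W A B :=
  [/\ measurable A, measurable B, nu (A `&` B) = 0 &
      {ae nu \x nu, forall p : T * T, A p.1 -> B p.2 -> W p.1 p.2 = 1%R}].

Definition irreducible_kernel D nu W :=
  ~ exists B : set T,
      [/\ measurable B, B `<=` D, 0 < nu B < 1 & prec nu W B (D `\` B)].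

Definition transitive_kernel D nu W :=
  {ae nu \x nu \x nu, forall p : T * T * T,
     D p.1.1 -> D p.1.2 -> D p.2 ->
     (0 < W p.1.1 p.1.2)%R -> (0 < W p.1.2 p.2)%R -> W p.1.1 p.2 = 1%R}.

Definition Zfamily nu W : set (set T) :=
  [set A | measurable A /\
     exists B C : set T,
       [/\ measurable B, measurable C, B `|` C = ~` A & B `&` C = set0] /\
       [/\ prec nu W B A, prec nu W A C & prec nu W B C]].

Definition sigmaZ nu W : set (set T) := <<s Zfamily nu W >>.

Definition atom (G : set (set T)) nu A :=
  [/\ G A, 0 < nu A &
      ~ exists A' : set T, [/\ G A', A' `<=` A & 0 < nu A' < nu A]].

Definition nonatomic (G : set (set T)) D nu :=
  forall A, A `<=` D -> ~ atom G nu A.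

End kernels.

Section atoms.
Context {d : measure_display} {T : measurableType d} {R : realType}.
Context {Q : countType}.
Implicit Types (S : Q -> set T) (mu : probability T R) (W : T -> T -> R).

(* Atoms only matter up to null sets: S picks one representative in each class,
   and the representatives are chosen disjoint. *)
Definition atom_enumeration (G : set (set T)) mu S :=
  [/\ forall i, atom G mu (S i),
      trivIset [set: Q] S &
      forall A, atom G mu A ->
        exists i, mu ((A `\` S i) `|` (S i `\` A)) = 0].

Definition nonatomic_part S : set T := ~` \bigcup_i S i.

Definition dominated_atoms mu W S (x : T) : set Q :=
  [set j | {ae mu, forall y, S j y -> W x y = 1%R}].

Definition Lambda mu W S (x : T) : \bar R :=
  \int[mu]_(y in nonatomic_part S) (W x y)%:E
  + \esum_(j in dominated_atoms mu W S x) mu (S j).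

(* Defined on the disjoint union of Q and nonatomic_part S; the values at
   inr x for x outside nonatomic_part S are irrelevant. *)
Definition eta_map mu W S (u : Q + T) : R :=
  match u with
  | inl i => (1 - (fine (mu (S i)))^-1 * fine (\int[mu]_(x in S i) Lambda mu W S x)
              - fine (mu (S i)))%R
  | inr x => (1 - fine (Lambda mu W S x))%R
  end.

End atoms.

(* The direct sum of kernels (\bigoplus_i alpha_i W_i, I, eta), where the
   disjoint union of I and the S_i is realised inside one space T, the S_i
   being disjoint parts of T and I the rest. *)
Section direct_sum.
Context {d : measure_display} {T : measurableType d} {R : realType}.
Context {Q : countType}.

Definition dsum_measure (alpha : Q -> \bar R) (mu_ : Q -> probability T R)
    (muI : probability T R) (A : set T) : \bar R :=
  (1 - \esum_(i in [set: Q]) alpha i) * muI A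
  + \esum_(i in [set: Q]) (alpha i * mu_ i A).

Definition dsum_eta (S : Q -> set T) (eta : Q + T -> R) (x : T) : R :=
  match pselect (exists i, S i x) with
  | left h => eta (inl (projT1 (cid h)))
  | right _ => eta (inr x)
  end.

(* The last value (x and y not in the same S_i but with the same eta) is
   arbitrary: it is taken on a null set when eta is injective as required. *)
Definition dsum_kernel (S : Q -> set T) (W_ : Q -> T -> T -> R)
    (eta : Q + T -> R) (x y : T) : R :=
  match pselect (exists i, S i x /\ S i y) with
  | left h => W_ (projT1 (cid h)) x y
  | right _ =>
      if (dsum_eta S eta x < dsum_eta S eta y)%R then 1%R
      else if (dsum_eta S eta y < dsum_eta S eta x)%R then 0%R
      else (2^-1)%R
  end.

End direct_sum.

(* Main.v *)
(* Call a measurable U a cut if U precedes its complement. The members of Z are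
   the differences of nested cuts; cuts are closed under countable unions and
   intersections, and W x y + W y x = 1 makes them a chain up to null sets.
   Every such chain is, up to null sets, a family of sublevel sets of a single
   function pos, where pos x is the measure of the smallest cut containing x,
   obtained as an infimum over maximal cuts of measure at most q, q rational.
   Then W x y = 1 for a.e. pair with pos x < pos y, and every cut contains or
   avoids a.e. each level of pos. Hence the atoms of sigma(Z) are, up to null
   sets, the levels {pos = lev i} of positive measure, and pos is injective up
   to null sets on the rest. Moreover Lambda = 1 - pos a.e., so that eta = pos
   a.e. on the nonatomic part, while eta(i) = mu {pos < lev i}: eta and pos
   order a.e. pair of points of different components in the same way. *)

From mathcomp Require Import measurable_realfun lra.
Require Import Defs.

Local Open Scope classical_set_scope.
Local Open Scope ring_scope.
Local Open Scope ereal_scope.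

(** * Almost everywhere statements *)

Section almost_everywhere.
Context {d : measure_display} {T : measurableType d} {R : realType}.
Implicit Types (m n : {measure set T -> \bar R}) (A B : set T) (P : T -> Prop).

Lemma ae_notinP m A : measurable A -> {ae m, forall x, ~ A x} <-> m A = 0.
Proof.
move=> mA; rewrite -(negligibleP m mA); split; apply: negligibleS => x.
  by move=> Ax; apply.
exact: contrapT.
Qed.

Lemma ae_forall_countable m (J : countType) (P : J -> T -> Prop) :
  (forall j, {ae m, forall x, P j x}) -> {ae m, forall x, forall j, P j x}.
Proof.
move=> aeP.
have : {ae m, forall x, forall k, if unpickle k is Some j then P j x else True}.
  apply: ae_foralln => k; case: unpickle => [j|]; [exact: aeP|exact: aeW].
by apply: filterS => x Px j; have := Px (pickle j); rewrite pickleK.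
Qed.

Lemma null_dominates_ae m n P :
  n `<< m -> {ae m, forall x, P x} -> {ae n, forall x, P x}.
Proof.
by move=> /null_content_dominatesP nm [N [mN N0 PN]]; exists N; split=> //;
  exact: nm.
Qed.

Lemma le_measure_ae m A B : measurable A -> measurable B ->
  {ae m, forall x, A x -> B x} -> m A <= m B.
Proof.
move=> mA mB [N [mN N0 AB]]; rewrite -[leRHS]adde0 -[X in _ + X]N0.
apply: le_trans (measureU2 m mB mN); apply: le_measure; rewrite ?inE//.
  exact: measurableU.
move=> x Ax; have [Bx|nBx] := pselect (B x); [by left|right].
by apply: AB => /(_ Ax).
Qed.

Lemma eq_measure_ae m A B : measurable A -> measurable B ->
  {ae m, forall x, A x <-> B x} -> m A = m B.
Proof.
move=> mA mB AB; apply/eqP; rewrite eq_le !le_measure_ae//.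
  by apply: filterS AB => x [].
by apply: filterS AB => x [].
Qed.

Lemma ae_subset_sym m A B : measurable A -> measurable B -> m A < +oo ->
  {ae m, forall x, A x -> B x} -> m B <= m A -> {ae m, forall x, B x -> A x}.
Proof.
move=> mA mB Afin AB BA; have Bfin := le_lt_trans BA Afin.
have mBA : m (B `&` A) = m A.
  apply: eq_measure_ae => //; first exact: measurableI.
  by apply: filterS AB => x ABx; split=> [[]//|Ax]; split=> //; exact: ABx.
have /ae_notinP : m (B `\` A) = 0.
  apply/eqP; rewrite -measure_le0 measureD// [X in _ - X]mBA sube_le0//.
move/(_ (measurableD mB mA)); apply: filterS => x nBA Bx.
by apply: contrapT => nAx; apply: nBA.
Qed.

Lemma ae_exists m A P : measurable A -> 0 < m A ->
  {ae m, forall x, P x} -> exists2 x, A x & P x.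
Proof.
move=> mA A0 aeP; apply: contrapT => nP; move: A0.
suff -> : m A = 0 by rewrite ltxx.
apply/ae_notinP => //; apply: filterS aeP => x Px Ax.
by apply: nP; exists x.
Qed.

End almost_everywhere.

Section almost_everywhere_products.
Context {d1 d2 : measure_display} {T1 : measurableType d1}
  {T2 : measurableType d2} {R : realType}.
Context (m1 : {measure set T1 -> \bar R})
  (m2 : {sigma_finite_measure set T2 -> \bar R}).

Lemma product_measure_eq0P (N : set (T1 * T2)) : measurable N ->
  (m1 \x m2) N = 0 <-> {ae m1, forall x, m2 (xsection N x) = 0}.
Proof.
move=> mN; have mf := measurable_fun_xsection m2 mN.
have -> : (m1 \x m2) N = \int[m1]_x `|m2 (xsection N x)|.
  by apply: eq_integral => x _; rewrite /= gee0_abs.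
rewrite (ae_eq_integral_abs m1 measurableT mf).
by split; apply: filterS => x // /(_ Logic.I).
Qed.

Lemma ae_prod_xsection (P : T1 * T2 -> Prop) :
  {ae m1 \x m2, forall p, P p} ->
  {ae m1, forall x, {ae m2, forall y, P (x, y)}}.
Proof.
move=> [N [mN /(product_measure_eq0P mN) N0 PN]].
apply: filterS N0 => x Nx0; exists (xsection N x); split=> //.
  exact: measurable_xsection.
by move=> y nP; rewrite /xsection /= inE; exact: PN.
Qed.

Lemma ae_xsectionP (P : set (T1 * T2)) x : measurable P ->
  {ae m2, forall y, P (x, y)} <-> m2 (xsection (~` P) x) = 0.
Proof.
move=> mP; rewrite -(negligibleP m2 (measurable_xsection x (measurableC mP))).
rewrite (_ : xsection _ _ = ~` [set y | P (x, y)])//.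
by apply/seteqP; split=> y; rewrite /xsection /= inE.
Qed.

Lemma ae_prodP (P : set (T1 * T2)) : measurable P ->
  {ae m1 \x m2, forall p, P p} <->
  {ae m1, forall x, {ae m2, forall y, P (x, y)}}.
Proof.
move=> mP; split; first exact: ae_prod_xsection.
move=> aeP; apply/(negligibleP _ (measurableC mP))/product_measure_eq0P.
  exact: measurableC.
by apply: filterS aeP => x /ae_xsectionP; exact.
Qed.

Lemma measurable_ae_xsection (P : set (T1 * T2)) : measurable P ->
  measurable [set x | {ae m2, forall y, P (x, y)}].
Proof.
move=> mP.
rewrite (_ : [set x | _] = (m2 \o xsection (~` P)) @^-1` [set 0]).
  rewrite -[X in measurable X]setTI.
  by apply: (measurable_fun_xsection m2 (measurableC mP)).
by apply/seteqP; split=> x /ae_xsectionP; exact.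
Qed.

Lemma ae_prod_fst (P : T1 -> Prop) :
  {ae m1, forall x, P x} -> {ae m1 \x m2, forall p, P p.1}.
Proof.
move=> [N [mN N0 PN]]; exists (N `*` setT); split.
- exact: measurableX.
- by rewrite product_measure1E// [X in X * _]N0 mul0e.
- by move=> p nP; split=> //; exact: PN.
Qed.

Lemma ae_prod_snd (P : T2 -> Prop) :
  {ae m2, forall x, P x} -> {ae m1 \x m2, forall p, P p.2}.
Proof.
move=> [N [mN N0 PN]]; exists (setT `*` N); split.
- exact: measurableX.
- by rewrite product_measure1E// [X in _ * X]N0 mule0.
- by move=> p nP; split=> //; exact: PN.
Qed.

Lemma ae_prod_and (P1 : T1 -> Prop) (P2 : T2 -> Prop) :
  {ae m1, forall x, P1 x} -> {ae m2, forall y, P2 y} ->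
  {ae m1 \x m2, forall p, P1 p.1 /\ P2 p.2}.
Proof.
by move=> /ae_prod_fst aeP1 /ae_prod_snd aeP2; apply: filterS2 aeP1 aeP2.
Qed.

Lemma ae_prod_neq (f : T1 -> R) (g : T2 -> R) (D : set T2) :
  measurable_fun [set: T1] f -> measurable_fun [set: T2] g -> measurable D ->
  (forall c, {ae m2, forall y, D y -> g y <> c}) ->
  {ae m1 \x m2, forall p, D p.2 -> f p.1 <> g p.2}.
Proof.
move=> mf mg mD g_neq.
apply/(ae_prodP (P := [set p | D p.2 -> f p.1 <> g p.2])); last first.
  by apply: aeW => x; apply: filterS (g_neq (f x)) => y gy /gy /nesym.
rewrite (_ : [set p | _] = ~` ((snd @^-1` D) `&`
    ((fun p => f p.1 - g p.2)%R @^-1` [set 0%R]))).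
  apply/measurableC/measurableI.
    by rewrite -[X in measurable X]setTI; exact: measurable_snd.
  rewrite -[X in measurable X]setTI.
  by apply: measurable_funB => //; exact: measurableT_comp.
apply/seteqP; split=> p /= fg; first by move=> [/fg] /[swap] /subr0_eq.
by move=> Dp fgp; apply: fg; rewrite fgp subrr.
Qed.

End almost_everywhere_products.

Lemma null_dominates_prod {d1 d2 : measure_display} {T1 : measurableType d1}
    {T2 : measurableType d2} {R : realType}
    (m1 n1 : {measure set T1 -> \bar R})
    (m2 n2 : {sigma_finite_measure set T2 -> \bar R}) :
  n1 `<< m1 -> n2 `<< m2 -> n1 \x n2 `<< m1 \x m2.
Proof.
move=> nm1 /null_content_dominatesP nm2; apply/null_content_dominatesP.
move=> N mN /(product_measure_eq0P m1 m2 mN)/(null_dominates_ae nm1) N0.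
apply/product_measure_eq0P => //.
by apply: filterS N0 => x; apply: nm2; exact: measurable_xsection.
Qed.

Lemma ae_prod_comp_fst {d0 d1 d2 : measure_display} {T0 : measurableType d0}
    {T1 : measurableType d1} {T2 : measurableType d2} {R : realType}
    (m0 : {measure set T0 -> \bar R}) (m1 : {measure set T1 -> \bar R})
    (m2 : {sigma_finite_measure set T2 -> \bar R})
    (f : T0 -> T1) (P : T1 * T2 -> Prop) : measurable_fun [set: T0] f ->
  (forall X : T1 -> Prop,
     {ae m1, forall x, X x} -> {ae m0, forall x, X (f x)}) ->
  {ae m1 \x m2, forall p, P p} ->
  {ae m0 \x m2, forall p, P (f p.1, p.2)}.
Proof.
move=> mf aef [N [mN N0 PN]].
pose g (p : T0 * T2) := (f p.1, p.2).
have mg : measurable_fun setT g.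
  by apply: measurable_fun_pair => //; exact: measurableT_comp.
have mgN : measurable (g @^-1` N) by rewrite -[_ @^-1` _]setTI; exact: mg.
exists (g @^-1` N); split=> //; last by move=> p nP; exact: PN.
apply/product_measure_eq0P => //.
exact: aef _ ((product_measure_eq0P m1 m2 mN).1 N0).
Qed.

Lemma ae_prod_swap {d1 d2 : measure_display} {T1 : measurableType d1}
    {T2 : measurableType d2} {R : realType}
    (m1 : {sigma_finite_measure set T1 -> \bar R})
    (m2 : {sigma_finite_measure set T2 -> \bar R}) (P : T1 * T2 -> Prop) :
  {ae m1 \x m2, forall p, P p} -> {ae m2 \x m1, forall p, P (p.2, p.1)}.
Proof.
move=> [N [mN N0 PN]].
pose swap (p : T2 * T1) := (p.2, p.1).
have mswapN : measurable (swap @^-1` N).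
  have mswap : measurable_fun setT swap by exact: measurable_fun_pair.
  by rewrite -[_ @^-1` _]setTI; exact: mswap.
exists (swap @^-1` N); split=> //; last by move=> p nP; exact: PN.
have -> : (m2 \x m1) (swap @^-1` N) = (m2 \x^ m1) (swap @^-1` N).
  apply: (product_measure_unique (m' := (m2 \x^ m1)%E)) => //.
  by move=> A B mA mB; exact: product_measure2E.
rewrite /product_measure2 -[RHS]N0; apply: eq_integral => x _ /=.
by congr (m2 _); apply/seteqP; split=> y; rewrite /xsection /ysection /= !inE.
Qed.

(** * Countable families *)

Section countable_families.
Context {J : countType} {R : realType}.

Lemma bigcup_pickle_inv {T : Type} (F : J -> set T) :
  \bigcup_j F j = \bigcup_n oapp F set0 (pickle_inv n).
Proof.
apply/seteqP; split=> [x [j _ Fjx]|x [n _]].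
  by exists (pickle j) => //; rewrite pickleK_inv.
by case: pickle_inv => //= j Fjx; exists j.
Qed.

Lemma esum_pickle_inv (a : J -> \bar R) : (forall j, 0 <= a j) ->
  \esum_(j in [set: J]) a j = \sum_(n <oo) oapp a 0 (pickle_inv n).
Proof.
move=> a0; rewrite nneseries_esumT; last by move=> n; case: pickle_inv.
transitivity (\esum_(n in range (@pickle J)) oapp a 0 (pickle_inv n)).
  rewrite esum_image; last by move=> i j _ _; exact: (pcan_inj (@pickleK J)).
  by apply: eq_esum => i _; rewrite pickleK_inv.
rewrite esum_mkcond; apply: eq_esum => n _; case: ifPn => // /negP nJ.
case Ej : pickle_inv => [j|//]; exfalso; apply/nJ/mem_set; exists j => //.
by have := @pickle_invK J n; rewrite Ej.
Qed.

Context {d : measure_display} {T : measurableType d}.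

Lemma countable_bigcup_measurable (D : set J) (F : J -> set T) :
  (forall j, D j -> measurable (F j)) -> measurable (\bigcup_(j in D) F j).
Proof.
move=> mF; rewrite bigcup_mkcond; apply: countable_bigcupT_measurable => // j.
by case: ifPn => // /set_mem /mF.
Qed.

Lemma measure_bigcup_countable (m : {measure set T -> \bar R})
    (F : J -> set T) : (forall j, measurable (F j)) -> trivIset setT F ->
  m (\bigcup_j F j) = \esum_(j in [set: J]) m (F j).
Proof.
move=> mF tF; rewrite esum_pickle_inv// bigcup_pickle_inv measure_bigcup//.
- rewrite (eq_eseriesl (Q := xpredT)); last by move=> n; rewrite in_setT.
  by apply: eq_eseriesr => n _; case: pickle_inv => //=; rewrite measure0.
- by move=> n _; case: pickle_inv => //=.
- move=> n k _ _ [x []].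
  have := @pickle_invK J n; have := @pickle_invK J k.
  case: pickle_inv => //= i; case: pickle_inv => //= j <- <- Fjx Fix.
  by congr pickle; apply: tF => //; exists x.
Qed.

Lemma ge0_emeasurable_esum (D : set T) (f : J -> T -> \bar R) :
  (forall j x, 0 <= f j x) -> (forall j, measurable_fun D (f j)) ->
  measurable_fun D (fun x => \esum_(j in [set: J]) f j x).
Proof.
move=> f0 mf; under eq_fun do rewrite esum_pickle_inv//.
pose g n x := oapp (f ^~ x) 0 (pickle_inv n).
rewrite (_ : (fun x => _) = (fun x => \sum_(n <oo | n \in xpredT) g n x)).
  by apply: ge0_emeasurable_sum => [n x _ _|n _]; rewrite /g;
    case: (pickle_inv n) => [j|] //=; exact: measurable_cst.
by apply/funext => x; exact: eq_eseriesl.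
Qed.

End countable_families.

(** * Zero-one laws and atoms *)

Section zero_one_laws.
Context {d : measure_display} {T : measurableType d} {R : realType}.
Implicit Types (m : {measure set T -> \bar R}) (A E : set T).

Definition zero_one_on m A E :=
  {ae m, forall x, A x -> E x} \/ {ae m, forall x, A x -> ~ E x}.

Lemma zero_one_on_sigma_algebra m A :
  sigma_algebra setT [set E | zero_one_on m A E].
Proof.
split=> [|E AE|F AF].
- by right; apply: aeW => x _ [].
- rewrite setTD /=; case: AE => AE; [right|left].
    by apply: filterS AE => x /[apply] Ex nEx.
  exact: AE.
- have [[n Fn]|nF] := pselect (exists n, {ae m, forall x, A x -> F n x}).
    by left; apply: filterS Fn => x /[apply] Fnx; exists n.
  right; have : {ae m, forall x, forall n, A x -> ~ F n x}.
    apply: ae_foralln => n; case: (AF n) => // Fn.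
    by exfalso; apply: nF; exists n.
  by apply: filterS => x nFx Ax [n _]; exact: nFx.
Qed.

Lemma zero_one_on_sigma m A (G : set (set T)) :
  (forall E, G E -> zero_one_on m A E) ->
  forall E, <<s G >> E -> zero_one_on m A E.
Proof.
by move=> AG; apply: smallest_sub => //; exact: zero_one_on_sigma_algebra.
Qed.

Lemma zero_one_onD m A E F :
  zero_one_on m A E -> zero_one_on m A F -> zero_one_on m A (E `\` F).
Proof.
move=> [] AE [] AF.
- by right; apply: filterS AF => x /[apply] Fx [].
- by left; apply: filterS2 AE AF => x Ex Fx Ax; split; [exact: Ex|exact: Fx].
- by right; apply: filterS AE => x /[apply] nEx [].
- by right; apply: filterS AE => x /[apply] nEx [].
Qed.

(* Almost all points of A satisfy the same inequalities f x < q, q rational. *)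
Lemma zero_one_on_ae_constant m A (f : T -> R) :
  (forall t, zero_one_on m A [set x | f x < t]%R) ->
  exists c, {ae m, forall x, A x -> f x = c}.
Proof.
move=> A01.
have /choice[B fB] (q : rat) :
    exists b : bool, {ae m, forall x, A x -> (f x < ratr q)%R = b}.
  case: (A01 (ratr q)) => Aq; [by exists true|exists false].
  by apply: filterS Aq => x /[apply]/negP/negbTE.
have {}fB : {ae m, forall x, forall q, A x -> (f x < ratr q)%R = B q}.
  exact: ae_forall_countable.
have le_f a b : (forall q, (f a < ratr q)%R = B q) ->
    (forall q, (f b < ratr q)%R = B q) -> (f a <= f b)%R.
  move=> fa fb; rewrite leNgt; apply/negP => /rat_in_itvoo[q].
  by rewrite in_itv/= fb -fa => /andP[aq /(lt_trans aq)]; rewrite ltxx.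
have [[a fa]|noB] := pselect (exists a, forall q, (f a < ratr q)%R = B q).
  exists (f a); apply: filterS fB => x fx Ax.
  by apply: le_anti; rewrite !le_f// => q; exact: fx.
exists 0%R; apply: filterS fB => x fx Ax; exfalso; apply: noB.
by exists x => q; exact: fx.
Qed.

End zero_one_laws.

Section atoms_of_families.
Context {d : measure_display} {T : measurableType d} {R : realType}
  (nu : probability T R) (G : set (set T)).
Hypothesis measurableG : G `<=` measurable.

Lemma atom_zero_one A E : atom G nu A -> G (A `&` E) -> zero_one_on nu A E.
Proof.
move=> [GA A0 minA] GAE; have mA := measurableG GA.
have mAE := measurableG GAE.
have [AE0|AE0] := eqVneq (nu (A `&` E)) 0.
  right; apply: filterS ((ae_notinP nu mAE).2 AE0) => x nAE Ax Ex.
  exact: nAE.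
left; have : {ae nu, forall x, A x -> (A `&` E) x}.
  apply: ae_subset_sym => //; first by rewrite ltey_eq fin_num_measure.
    by apply: aeW => x [].
  rewrite leNgt; apply/negP => AEltA; apply: minA; exists (A `&` E); split=> //.
  by rewrite lt0e AE0 measure_ge0.
by apply: filterS => x /[apply] -[].
Qed.

Lemma zero_one_atom A : G A -> 0 < nu A ->
  (forall E, G E -> zero_one_on nu A E) -> atom G nu A.
Proof.
move=> GA A0 A01; split=> // -[E [GE EA /andP[E0]]].
have mA := measurableG GA; have mE := measurableG GE.
case: (A01 E GE) => AE; rewrite ltNge => /negP; apply.
  exact: le_measure_ae.
suff nuE0 : nu E = 0 by rewrite nuE0 ltxx in E0.
apply/ae_notinP => //; apply: filterS AE => x AEx Ex.
exact: AEx (EA _ Ex) Ex.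
Qed.

Lemma nonatomic_null_levels (D : set T) (f : T -> R) :
  (forall A t, G A -> G (A `&` [set x | f x < t]%R)) ->
  (forall c, {ae nu, forall x, D x -> f x <> c}) -> nonatomic G D nu.
Proof.
move=> Gf fD A AD atomA; have [GA A0 _] := atomA.
have [t|c fc] := zero_one_on_ae_constant (A := A) (f := f) (m := nu).
  by apply: atom_zero_one => //; exact: Gf.
move: A0; suff -> : nu A = 0 by rewrite ltxx.
apply/ae_notinP; first exact: measurableG.
by apply: filterS2 fc (fD c) => x fx Dx Ax; exact: Dx (AD _ Ax) (fx Ax).
Qed.

End atoms_of_families.

(** * Conditional probabilities *)

Section conditional_probabilities.
Context {d : measure_display} {T : measurableType d} {R : realType}
  (P : probability T R).
Implicit Types A B : set T.

Lemma cond_probE A B : measurable A -> 0 < P A ->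
  cond_prob P A B = P (B `&` A) / P A.
Proof.
move=> mA A0; rewrite /cond_prob; case: pselect => // mA'.
have PA_fin : P A \is a fin_num by rewrite fin_num_measure.
rewrite /= /mnormalize /= /mrestr setTI gt_eqF//= lt_eqF; last first.
  by rewrite ltey_eq PA_fin.
by rewrite -[in RHS](fineK PA_fin) inver gt_eqF// fine_gt0// A0 ltey_eq PA_fin.
Qed.

Lemma cond_prob0 A : P A = 0 -> cond_prob P A = P :> (set T -> \bar R).
Proof.
move=> A0; rewrite /cond_prob; case: pselect => // mA; apply/funext => B.
by rewrite /= /mnormalize /= /mrestr setTI [X in X == 0]A0 eqxx.
Qed.

Lemma mule_cond_prob A B : measurable A -> measurable B ->
  P A * cond_prob P A B = P (B `&` A).
Proof.
move=> mA mB; have [A0|A0] := eqVneq (P A) 0.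
  rewrite A0 mul0e; apply/esym/(subset_measure0 _ mA _ A0).
    exact: measurableI.
  exact: subIsetr.
rewrite cond_probE// ?lt0e ?A0 ?measure_ge0//.
by rewrite muleCA divee ?mule1// fin_num_measure.
Qed.

Lemma cond_prob_dominated A : cond_prob P A `<< P.
Proof.
apply/null_content_dominatesP => B mB B0.
have [mA|nmA] := pselect (measurable A); last first.
  by rewrite /cond_prob; case: pselect.
have [A0|A0] := eqVneq (P A) 0; first by rewrite cond_prob0.
rewrite cond_probE ?lt0e ?A0 ?measure_ge0// [X in X / _](_ : _ = 0) ?mul0e//.
apply: (subset_measure0 _ mB _ B0); [exact: measurableI|exact: subIsetl].
Qed.

Lemma ae_cond_prob A (X : T -> Prop) : measurable A -> 0 < P A ->
  {ae cond_prob P A, forall x, X x} -> {ae P, forall x, A x -> X x}.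
Proof.
move=> mA A0 [N [mN N0 XN]]; have mNA := measurableI _ _ mN mA.
have /ae_notinP : P (N `&` A) = 0 by rewrite -mule_cond_prob// N0 mule0.
move=> /(_ mNA); apply: filterS => x nNA Ax; apply: contrapT => nXx.
by apply: nNA; split=> //; exact: XN.
Qed.

Lemma ae_prod_cond_prob A (X : T * T -> Prop) : measurable A -> 0 < P A ->
  {ae cond_prob P A \x cond_prob P A, forall p, X p} ->
  {ae P \x P, forall p : T * T, A p.1 -> A p.2 -> X p}.
Proof.
move=> mA A0 [N [mN N0 XN]].
have N_ae : {ae cond_prob P A \x cond_prob P A, forall p, ~ N p}.
  exact/ae_notinP.
suff : {ae P \x P, forall p, ~ (N `&` (A `*` A)) p}.
  apply: filterS => p nNA A1 A2; apply: contrapT => nXp.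
  by apply: nNA; split=> //; exact: XN.
have mNA : measurable (~` (N `&` (A `*` A))).
  by apply/measurableC/measurableI => //; exact: measurableX.
apply/(ae_prodP P P mNA).
apply: filterS (ae_cond_prob mA A0 (ae_prod_xsection N_ae)) => x nNx.
have [Ax|nAx] := pselect (A x); last by apply: aeW => y [_ []].
by apply: filterS (ae_cond_prob mA A0 (nNx Ax)) => y nNxy [Nxy [_ /nNxy]].
Qed.

End conditional_probabilities.

(** * Components *)

Section components.
Context {d : measure_display} {T : measurableType d} {R : realType}
  (mu : probability T R) {Q : countType} (S : Q -> set T)
  (mS : forall i, measurable (S i)) (trivS : trivIset setT S).

Lemma component_inj i j x : S i x -> S j x -> i = j.
Proof. by move=> Six Sjx; apply: trivS => //; exists x. Qed.

Lemma nonatomic_partN i x : nonatomic_part S x -> ~ S i x.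
Proof. by move=> Ix Six; apply: Ix; exists i. Qed.

Lemma nonatomic_part_or x : nonatomic_part S x \/ exists i, S i x.
Proof.
have [[i Six]|nSx] := pselect (exists i, S i x); [by right; exists i|left].
by move=> [i _ Six]; apply: nSx; exists i.
Qed.

Lemma nonatomic_part_partition :
  [/\ trivIset setT S, forall i, nonatomic_part S `&` S i = set0 &
      [set: T] = nonatomic_part S `|` \bigcup_i S i].
Proof.
split=> // [i|]; last by rewrite /nonatomic_part setvU.
by apply/seteqP; split=> x // [Ix Six]; have := nonatomic_partN Ix Six.
Qed.

Lemma dsum_eta_component (eta : Q + T -> R) i x : S i x ->
  dsum_eta S eta x = eta (inl i).
Proof.
move=> Six; rewrite /dsum_eta; case: pselect => [ex|]; last by case; exists i.
by case: (cid ex) => j Sjx /=; rewrite (component_inj Sjx Six).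
Qed.

Lemma dsum_eta_nonatomic (eta : Q + T -> R) x :
  nonatomic_part S x -> dsum_eta S eta x = eta (inr x).
Proof.
move=> Ix; rewrite /dsum_eta; case: pselect => // -[i Six].
by have := nonatomic_partN Ix Six.
Qed.

Lemma measurable_nonatomic_part : measurable (nonatomic_part S).
Proof. by apply/measurableC/countable_bigcup_measurable. Qed.

Lemma measure_components A : measurable A ->
  mu A = mu (A `&` nonatomic_part S) + \esum_(i in [set: Q]) mu (A `&` S i).
Proof.
move=> mA; rewrite -measure_bigcup_countable; first last.
- exact: trivIset_setIl.
- by move=> i; exact: measurableI.
rewrite -setI_bigcupr /nonatomic_part -setDE; apply: measureDI => //.
exact: countable_bigcup_measurable.
Qed.

Lemma dsum_measureE A : measurable A ->
  mu A = dsum_measure (fun i => mu (S i)) (fun i => cond_prob mu (S i))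
    (cond_prob mu (nonatomic_part S)) A.
Proof.
move=> mA; rewrite /dsum_measure (measure_components mA).
have mI := measurable_nonatomic_part.
have -> : 1 - \esum_(i in [set: Q]) mu (S i) = mu (nonatomic_part S).
  rewrite -measure_bigcup_countable// [RHS]probability_setC//.
  exact: countable_bigcup_measurable.
rewrite mule_cond_prob//; congr (_ + _).
by apply: eq_esum => i _; rewrite mule_cond_prob.
Qed.

End components.

(** * Chains of sets up to null sets *)

Lemma sublevel_bigcap {T : Type} {R : realType} (f : T -> R) t :
  [set x | f x <= t]%R = \bigcap_n [set x | f x < t + n.+1%:R^-1]%R.
Proof.
apply/seteqP; split=> [x /= fxt n _ /=|x fx /=].
  by apply: le_lt_trans fxt _; rewrite ltrDl invr_gt0.
rewrite leNgt; apply/negP => /ltr_add_invr[n].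
by rewrite ltNge ltW//; exact: fx.
Qed.

Section essential_chains.
Context {d : measure_display} {T : measurableType d} {R : realType}
  (mu : {finite_measure set T -> \bar R}).

Definition essential_chain (K : set (set T)) :=
  [/\ K `<=` measurable,
      forall (D : set nat) F, (forall n, D n -> K (F n)) ->
        K (\bigcup_(n in D) F n),
      forall (D : set nat) F, (forall n, D n -> K (F n)) ->
        K (\bigcap_(n in D) F n) &
      forall U V, K U -> K V ->
        {ae mu, forall x, U x -> V x} \/ {ae mu, forall x, V x -> U x}].

(* The third clause normalises pos: pos x is the measure of the smallest member
   of K containing x. *)
Definition position (K : set (set T)) (pos : T -> R) :=
  [/\ forall t, K [set x | pos x < t]%R,
      forall t, K [set x | pos x <= t]%R,
      forall x, mu [set y | pos y <= pos x]%R = (pos x)%:E &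
      forall U, K U -> exists t, {ae mu, forall x, U x <-> (pos x <= t)%R}].

Context (K : set (set T)) (chainK : essential_chain K).

Let measurableK : K `<=` measurable. Proof. by case: chainK. Qed.

Let bigcupK (D : set nat) F :
  (forall n, D n -> K (F n)) -> K (\bigcup_(n in D) F n).
Proof. by case: chainK => _ + _ _; exact. Qed.

Lemma chain_set0 : K set0.
Proof.
by rewrite -(bigcup_set0 (fun _ : nat => set0 : set T)); exact: bigcupK.
Qed.

Lemma chain_setU U V : K U -> K V -> K (U `|` V).
Proof. by move=> KU KV; rewrite -bigcup2inE; apply: bigcupK => -[|[|]]. Qed.

Lemma measure_chain_setU_le U V q : K U -> K V -> mu U <= q -> mu V <= q ->
  mu (U `|` V) <= q.
Proof.
move=> KU KV Uq Vq; have [_ _ _ /(_ U V KU KV) UV] := chainK.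
have mUV := measurableK (chain_setU KU KV).
case: UV => UV; [apply: le_trans Vq|apply: le_trans Uq];
  apply: le_measure_ae => //; try exact: measurableK.
- by apply: filterS UV => x UVx [/UVx|].
- by apply: filterS UV => x UVx [|/UVx].
Qed.

Lemma measure_chain_bigcup_le (D : set nat) F q : 0 <= q ->
  (forall n, D n -> K (F n)) -> (forall n, D n -> mu (F n) <= q) ->
  mu (\bigcup_(n in D) F n) <= q.
Proof.
move=> q0 KF Fq; pose G n := if n \in D then F n else set0.
pose S n := \big[setU/set0]_(i < n.+1) G i.
have -> : \bigcup_(n in D) F n = \bigcup_n S n.
  by rewrite bigcup_mkcond (bigcup_bigsetU_bigcup G).
have KS n : K (S n) /\ mu (S n) <= q.
  apply: (big_ind (fun X => K X /\ mu X <= q)) => [|X Y [KX Xq] [KY Yq]|i _].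
  - by rewrite measure0; split=> //; exact: chain_set0.
  - by split; [exact: chain_setU|exact: measure_chain_setU_le].
  - rewrite /G; case: ifPn => [/set_mem Di|_]; last first.
      by rewrite measure0; split=> //; exact: chain_set0.
    by split; [exact: KF|exact: Fq].
have cvgS : mu (S n) @[n --> \oo] --> mu (\bigcup_n S n).
  apply: nondecreasing_cvg_mu.
  - by move=> n; exact: measurableK (KS n).1.
  - by apply: bigcupT_measurable => n; exact: measurableK (KS n).1.
  - by move=> n k nk; apply/subsetPset; exact: subset_bigsetU.
rewrite -(cvg_lim _ cvgS)//; apply: lime_le; first exact: cvgP cvgS.
by apply: nearW => n; exact: (KS n).2.
Qed.

Lemma chain_maximal q : (0 <= q)%R -> exists U, [/\ K U, mu U <= q%:E &
  forall V, K V -> mu V <= q%:E -> {ae mu, forall x, V x -> U x}].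
Proof.
move=> q0; pose E := [set mu V | V in [set V | K V /\ mu V <= q%:E]].
have E0 : E 0.
  exists set0; rewrite /= ?measure0//.
  by split=> //; exact: chain_set0.
have supE_fin : ereal_sup E \is a fin_num.
  rewrite ge0_fin_numE; last exact: ereal_sup_ubound.
  by apply: le_lt_trans (ltry q); apply: ge_ereal_sup => _ [V [_ Vq] <-].
have /choice[F FP] n : exists V,
    [/\ K V, mu V <= q%:E & ereal_sup E - (n.+1%:R^-1)%:E < mu V].
  have ninv_gt0 : (0 < n.+1%:R^-1 :> R)%R by rewrite invr_gt0.
  have [_ [V [KV Vq] <-] EV] := ub_ereal_sup_adherent ninv_gt0 supE_fin.
  by exists V.
pose U := \bigcup_n F n.
have KU : K U by apply: bigcupK => n _; have [] := FP n.
have Uq : mu U <= q%:E.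
  by apply: measure_chain_bigcup_le => // n _; have [] := FP n.
have supE_le : ereal_sup E <= mu U.
  apply/lee_addgt0Pr => e /ltr_add_invr[n]; rewrite add0r => /ltW ne.
  have [KF _ /ltW EF] := FP n; rewrite -leeBlDr//.
  apply: le_trans (le_trans _ EF) _; first by rewrite leeB.
  by apply: le_measure; rewrite ?inE; [exact: measurableK..|exact: bigcup_sup].
exists U; split=> // V KV Vq.
have : {ae mu, forall x, (V `|` U) x -> U x}.
  apply: ae_subset_sym; try exact: measurableK.
  - exact/measurableK/chain_setU.
  - by rewrite ltey_eq fin_num_measure//; exact: measurableK.
  - by apply: aeW => x; right.
  - apply: le_trans supE_le; apply: ereal_sup_ubound; exists (V `|` U) => //.
    by split; [exact: chain_setU|exact: measure_chain_setU_le].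
by apply: filterS => x VUx Vx; apply: VUx; left.
Qed.

Lemma chain_outer_sequence : exists V : nat -> set T,
  [/\ forall n, K (V n), \bigcup_n V n = setT &
      forall U e, K U -> (0 < e)%R ->
        exists2 n, {ae mu, forall x, U x -> V n x} & mu (V n) < mu U + e%:E].
Proof.
have /choice[M MP] (q : rat) : exists U, [/\ K U, mu U <= `|ratr q|%:E &
    forall V, K V -> mu V <= `|ratr q|%:E -> {ae mu, forall x, V x -> U x}].
  exact: chain_maximal.
have KT : K setT.
  rewrite -(bigcap_set0 (fun _ : nat => set0 : set T)).
  by have [_ _ + _] := chainK; exact.
pose V n := if n is k.+1 then oapp M setT (unpickle k) else setT.
exists V; split.
- case=> [//|n] /=; case: unpickle => [q|//] /=.
  by have [] := MP q.
- by apply/seteqP; split=> // x _; exists 0%N.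
move=> U e KU e0; have mU := measurableK KU.
have : (fine (mu U) < fine (mu U) + e)%R by rewrite ltrDl.
move=> /rat_in_itvoo[q]; rewrite in_itv/= => /andP[Uq qe].
have q0 : (0 <= ratr q :> R)%R by rewrite (le_trans _ (ltW Uq))// fine_ge0.
have [_ Mq Mmax] := MP q; rewrite (ger0_norm q0) in Mq Mmax.
exists (pickle q).+1; rewrite /V pickleK /=.
  by apply: Mmax => //; rewrite -[leLHS]fineK ?fin_num_measure// lee_fin ltW.
apply: le_lt_trans Mq _.
by rewrite -[mu U]fineK ?fin_num_measure// -EFinD lte_fin.
Qed.

Section position_construction.
Context (V : nat -> set T) (KV : forall n, K (V n))
  (coverV : \bigcup_n V n = setT)
  (outerV : forall U e, K U -> (0 < e)%R ->
     exists2 n, {ae mu, forall x, U x -> V n x} & mu (V n) < mu U + e%:E).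

Let fineV n : (fine (mu (V n)))%:E = mu (V n).
Proof. by rewrite fineK// fin_num_measure//; exact: measurableK. Qed.

Definition least_measure x := inf [set fine (mu (V n)) | n in [set n | V n x]].

Lemma least_measure_le x n : V n x -> (least_measure x)%:E <= mu (V n).
Proof.
move=> Vnx; rewrite -fineV lee_fin; apply: ge_inf; last by exists n.
by exists 0%R => _ [k _ <-]; exact: fine_ge0.
Qed.

Lemma least_measure_ltP x t :
  (least_measure x < t)%R <-> exists2 n, V n x & mu (V n) < t%:E.
Proof.
split=> [lt_xt|[n Vnx nt]]; last first.
  by rewrite -lte_fin; exact: le_lt_trans (least_measure_le Vnx) nt.
have [n0 _ Vn0x] : (\bigcup_n V n) x by rewrite coverV.
have [|_ [n Vnx <-] nt] := inf_lt _ lt_xt.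
- by exists (fine (mu (V n0))), n0.
- by exists n; rewrite // -fineV lte_fin.
Qed.

Let sublevelE t : [set x | least_measure x < t]%R =
  \bigcup_(n in [set n | mu (V n) < t%:E]) V n.
Proof.
apply/seteqP; split=> x; first by move=> /least_measure_ltP[n Vnx nt]; exists n.
by move=> [n nt Vnx]; apply/least_measure_ltP; exists n.
Qed.

Lemma chain_least_measure_lt t : K [set x | least_measure x < t]%R.
Proof. by rewrite sublevelE; exact: bigcupK. Qed.

Lemma measure_least_measure_lt t : (0 <= t)%R ->
  mu [set x | least_measure x < t]%R <= t%:E.
Proof.
move=> t0; rewrite sublevelE; apply: measure_chain_bigcup_le => //= n.
exact: ltW.
Qed.

Lemma chain_least_measure_le t : K [set x | least_measure x <= t]%R.
Proof.
rewrite sublevel_bigcap; have [_ _ + _] := chainK; apply=> n _.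
exact: chain_least_measure_lt.
Qed.

Let measurable_lt t := measurableK (chain_least_measure_lt t).
Let measurable_le t := measurableK (chain_least_measure_le t).

Lemma measure_least_measure_le t : (0 <= t)%R ->
  mu [set x | least_measure x <= t]%R <= t%:E.
Proof.
move=> t0; apply/lee_addgt0Pr => e e0; rewrite -EFinD.
apply: le_trans (measure_least_measure_lt _); last by rewrite addr_ge0// ltW.
apply: le_measure; rewrite ?inE// => x /= xt.
by apply: le_lt_trans xt _; rewrite ltrDl.
Qed.

Lemma measure_least_measure x :
  mu [set y | least_measure y <= least_measure x]%R = (least_measure x)%:E.
Proof.
have [n0 _ Vn0x] : (\bigcup_n V n) x by rewrite coverV.
apply/eqP; rewrite eq_le measure_least_measure_le; last first.
  apply: lb_le_inf => [|_ [n _ <-]]; last exact: fine_ge0.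
  by exists (fine (mu (V n0))), n0.
pose F n := [set y | least_measure y < least_measure x + n.+1%:R^-1]%R.
have cvgF : mu (F n) @[n --> \oo] -->
    mu [set y | least_measure y <= least_measure x]%R.
  rewrite sublevel_bigcap; apply: nonincreasing_cvg_mu.
  - by rewrite ltey_eq fin_num_measure//; exact: measurable_lt.
  - by move=> n; exact: measurable_lt.
  - by apply: bigcapT_measurable => n; exact: measurable_lt.
  - move=> n k nk; apply/subsetPset => y /= /lt_le_trans; apply.
    by rewrite lerD2l lef_pV2 ?posrE// ler_nat.
rewrite -(cvg_lim _ cvgF)//; apply: lime_ge; first exact: cvgP cvgF.
apply: nearW => n; have : (least_measure x < least_measure x + n.+1%:R^-1)%R.
  by rewrite ltrDl invr_gt0.
move=> /least_measure_ltP[k Vkx kn].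
apply: le_trans (least_measure_le Vkx) _.
apply: le_measure; rewrite ?inE; [exact: measurableK|exact: measurable_lt|].
by move=> y Vky; apply/least_measure_ltP; exists k.
Qed.

Lemma chain_ae_least_measure U : K U ->
  {ae mu, forall x, U x <-> (least_measure x <= fine (mu U))%R}.
Proof.
move=> KU; have mU := measurableK KU; set t := fine (mu U).
have tE : mu U = t%:E by rewrite fineK// fin_num_measure.
have sub : {ae mu, forall x, U x -> (least_measure x <= t)%R}.
  have : {ae mu, forall x, forall n,
      U x -> (least_measure x < t + n.+1%:R^-1)%R}.
    apply: ae_foralln => n.
    have ninv_gt0 : (0 < n.+1%:R^-1 :> R)%R by rewrite invr_gt0.
    have [k UVk kn] := outerV KU ninv_gt0; apply: filterS UVk => x /[apply] Vkx.
    by apply/least_measure_ltP; exists k; rewrite // EFinD -tE.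
  apply: filterS => x xt Ux; suff : [set y | least_measure y <= t]%R x by [].
  by rewrite sublevel_bigcap => n _; exact: xt.
have sup : {ae mu, forall x, (least_measure x <= t)%R -> U x}.
  apply: ae_subset_sym sub _ => //; first exact: measurable_le.
    by rewrite [ltLHS]tE ltry.
  by rewrite [leRHS]tE; apply: measure_least_measure_le; exact: fine_ge0.
by apply: filterS2 sub sup => x; split.
Qed.

Lemma position_least_measure : position K least_measure.
Proof.
split; [exact: chain_least_measure_lt|exact: chain_least_measure_le|
  exact: measure_least_measure|].
by move=> U KU; exists (fine (mu U)); exact: chain_ae_least_measure.
Qed.

End position_construction.

Lemma exists_position : exists pos, position K pos.
Proof.
have [V [KV coverV outerV]] := chain_outer_sequence.
by exists (least_measure V); exact: position_least_measure.
Qed.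

End essential_chains.

(** * Cuts of a tournament kernel *)

Section cuts.
Context {d : measure_display} {T : measurableType d} {R : realType}
  (mu : probability T R) (W : T -> T -> R).
Implicit Types A B U V : set T.

Definition beats A B :=
  {ae mu \x mu, forall p : T * T, A p.1 -> B p.2 -> W p.1 p.2 = 1%R}.

Definition cut U := prec mu W U (~` U).

Lemma cutP U : cut U <-> measurable U /\ beats U (~` U).
Proof.
split=> [[mU _ _ UC]//|[mU UC]].
by split; rewrite ?setICr ?measure0//; exact: measurableC.
Qed.

Lemma Zfamily_setD_cut A : Zfamily mu W A ->
  exists U V, [/\ cut U, cut V & A = V `\` U].
Proof.
move=> [mA [B [C [[mB mC BCE BC0]]]]] [[_ _ _ BA] [_ _ _ AC] [_ _ _ BC]].
have ABC x : [\/ A x, B x | C x].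
  have [Ax|nAx] := pselect (A x); first by constructor 1.
  by have : (~` A) x by []; rewrite -BCE => -[]; [constructor 2|constructor 3].
exists B, (~` C); split.
- apply/cutP; split=> //; apply: filterS2 BA BC => p BAp BCp Bp nBp.
  by case: (ABC p.2) => // ?; [exact: BAp|exact: BCp].
- apply/cutP; split; first exact: measurableC.
  apply: filterS2 AC BC => p ACp BCp nCp /contrapT Cp.
  by case: (ABC p.1) => // ?; [exact: ACp|exact: BCp].
- apply/seteqP; split=> x; last by move=> [nCx nBx]; case: (ABC x).
  by move=> Ax; split=> ?; have : (B `|` C) x; [right| |left|];
    rewrite // BCE => /(_ Ax).
Qed.

Lemma sigmaZ_cut U : cut U -> sigmaZ mu W U.
Proof.
move=> cutU; have [mU mUC _ _] := cutU.
have prec0 B : measurable B -> prec mu W set0 B.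
  by move=> mB; split; rewrite ?set0I ?measure0//; apply: aeW => p.
apply: sub_sigma_algebra; split=> //; exists set0, (~` U).
split; first by rewrite set0U set0I.
by split; [exact: prec0|exact: cutU|exact: prec0].
Qed.

Lemma sigmaZ_measurable : sigmaZ mu W `<=` measurable.
Proof.
by apply: smallest_sub; [exact: sigma_algebra_measurable|move=> A []].
Qed.

Lemma sigmaZ_setI : setI_closed (sigmaZ mu W).
Proof. exact: (@measurableI _ (g_sigma_algebraType (Zfamily mu W))). Qed.

Lemma sigmaZ_setD : setD_closed (sigmaZ mu W).
Proof. exact: (@measurableD _ (g_sigma_algebraType (Zfamily mu W))). Qed.

Lemma cut_family_beats (D : set nat) (F : nat -> set T) :
  (forall n, D n -> cut (F n)) ->
  {ae mu \x mu, forall p : T * T, forall n, D n ->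
    F n p.1 -> ~ F n p.2 -> W p.1 p.2 = 1%R}.
Proof.
move=> cutF; apply: ae_foralln => n.
have [/cutF[_ _ _ Fn]|nDn] := pselect (D n); last exact: aeW.
by apply: filterS Fn => p Fp _; exact: Fp.
Qed.

Lemma cut_bigcup (D : set nat) (F : nat -> set T) :
  (forall n, D n -> cut (F n)) -> cut (\bigcup_(n in D) F n).
Proof.
move=> cutF; apply/cutP; split.
  by apply: bigcup_measurable => n /cutF[].
apply: filterS (cut_family_beats cutF) => p Fp [n Dn Fn1] nF2.
by apply: (Fp n) => // Fn2; apply: nF2; exists n.
Qed.

Lemma cut_bigcap (D : set nat) (F : nat -> set T) :
  (forall n, D n -> cut (F n)) -> cut (\bigcap_(n in D) F n).
Proof.
move=> cutF; apply/cutP; split.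
  by apply: bigcap_measurableType => n /cutF[].
apply: filterS (cut_family_beats cutF) => p Fp F1.
rewrite setC_bigcap => -[n Dn nFn2].
by apply: (Fp n) => //; exact: F1.
Qed.

Context (tourW : tournament_kernel setT mu W).

Lemma beats_asym A B : measurable A -> measurable B ->
  beats A B -> beats B A -> mu A = 0 \/ mu B = 0.
Proof.
rewrite /beats => mA mB AB /ae_prod_swap BA; have [_ _ W_sym] := tourW.
suff : (mu \x mu) (A `*` B) = 0.
  by rewrite product_measure1E// => /eqP; rewrite mule_eq0 => /orP[] /eqP;
    [left|right].
apply/ae_notinP; first exact: measurableX.
apply: filterS3 AB BA W_sym => p ABp BAp + [Ap Bp].
rewrite ABp// BAp// => /(_ Logic.I Logic.I)/eqP.
by rewrite -subr_eq0 addrK oner_eq0.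
Qed.

Lemma essential_chain_cut : essential_chain mu cut.
Proof.
split=> [U []//|||U V cutU cutV]; [exact: cut_bigcup|exact: cut_bigcap|].
have [mU _ _ UC] := cutU; have [mV _ _ VC] := cutV.
have mUV := measurableD mU mV; have mVU := measurableD mV mU.
have UV_VU : beats (U `\` V) (V `\` U).
  by apply: filterS UC => p Up [U1 _] [_ nU2]; exact: Up.
have VU_UV : beats (V `\` U) (U `\` V).
  by apply: filterS VC => p Vp [V1 _] [_ nV2]; exact: Vp.
case: (beats_asym mUV mVU UV_VU VU_UV) => /ae_notinP notin; [left|right];
  by apply: filterS (notin _) => // x nx xU; apply: contrapT => nxV; apply: nx.
Qed.

End cuts.

Section tournament_kernels.
Context {d : measure_display} {T : measurableType d} {R : realType}
  (mu : probability T R) (W : T -> T -> R)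
  (tourW : tournament_kernel setT mu W).

Lemma kernel_ge0 x y : (0 <= W x y)%R.
Proof. by have [_ /(_ x y Logic.I Logic.I)/andP[]] := tourW. Qed.

Lemma kernel_le1 x y : (W x y <= 1)%R.
Proof. by have [_ /(_ x y Logic.I Logic.I)/andP[]] := tourW. Qed.

Lemma measurable_kernel : measurable_fun setT (fun p : T * T => W p.1 p.2).
Proof. by have [+ _ _] := tourW; rewrite setXTT. Qed.

Lemma measurable_kernel_section D x :
  measurable_fun D (fun y => (W x y)%:E).
Proof.
apply/measurable_EFinP/measurable_funTS.
have mx : measurable_fun setT (fun y : T => (x, y)).
  exact: measurable_fun_pair.
exact: (measurableT_comp measurable_kernel mx).
Qed.

Lemma measurable_integral_kernel D : measurable D ->
  measurable_fun setT (fun x => \int[mu]_(y in D) (W x y)%:E).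
Proof.
move=> mD; pose f (p : T * T) := ((W p.1 p.2)%:E * (\1_D p.2)%:E).
rewrite (_ : (fun x => _) = fubini_F mu f); last first.
  apply/funext => x; rewrite /fubini_F [LHS]integral_mkcond.
  apply: eq_integral => y _; rewrite /f patchE indicE /=.
  by case: ifP => _; rewrite ?mule1 ?mule0.
apply: measurable_fun_fubini_tonelli_F => [|p].
  apply: emeasurable_funM; apply/measurable_EFinP; last exact: measurableT_comp.
  exact: measurable_kernel.
by rewrite mule_ge0// lee_fin kernel_ge0.
Qed.

Lemma measurable_kernel_eq1 A B : measurable A -> measurable B ->
  measurable [set p : T * T | A p.1 -> B p.2 -> W p.1 p.2 = 1%R].
Proof.
move=> mA mB; rewrite (_ : [set p | _] =
    ~` (A `*` B) `|` (fun p : T * T => W p.1 p.2) @^-1` [set 1%R]).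
  apply: measurableU; first by apply: measurableC; exact: measurableX.
  by rewrite -[X in measurable X]setTI; exact: measurable_kernel.
apply/seteqP; split=> p /=; last by move=> [nAB Ap Bp|//]; case: nAB.
move=> ABp; have [[Ap Bp]|nABp] := pselect ((A `*` B) p); last by left.
by right; exact: ABp.
Qed.

Lemma tournament_restriction (nu : probability T R) D :
  nu `<< mu -> tournament_kernel D nu W.
Proof.
move=> nu_mu; have [mW W01 W_sym] := tourW; split.
- by apply: measurable_funS mW; rewrite setXTT.
- by move=> x y _ _; exact: W01.
- apply: (null_dominates_ae (null_dominates_prod nu_mu nu_mu)).
  by apply: filterS W_sym => p Wp _ _; exact: Wp.
Qed.

Context {Q : countType} (S : Q -> set T)
  (mS : forall i, measurable (S i)) (trivS : trivIset setT S).

Lemma measurable_dominated j : measurable [set x | dominated_atoms mu W S x j].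
Proof.
rewrite (_ : [set x | _] =
    [set x | {ae mu, forall y, [set: T] x -> S j y -> W x y = 1%R}]).
  exact: (measurable_ae_xsection mu (measurable_kernel_eq1 measurableT (mS j))).
by apply/seteqP; split=> x; apply: filterS => y // /(_ Logic.I).
Qed.

Lemma ae_not_dominated_self :
  {ae mu, forall x, forall i, S i x -> ~ dominated_atoms mu W S x i}.
Proof.
apply: ae_forall_countable => i.
pose X := S i `&` [set x | dominated_atoms mu W S x i].
have mX : measurable X by apply: measurableI => //; exact: measurable_dominated.
have XX : beats mu W X X.
  apply/(ae_prodP mu mu (measurable_kernel_eq1 mX mX)).
  apply: aeW => x; have [[_ x_i]|nXx] := pselect (X x); last first.
    by apply: aeW => y /nXx.
  by apply: filterS x_i => y Wxy _ [Siy _]; exact: Wxy.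
have X0 : mu X = 0 by case: (beats_asym tourW mX mX XX XX).
by apply: filterS ((ae_notinP mu mX).2 X0) => x nXx Six x_i; exact: nXx.
Qed.

Lemma Lambda_ge0 x : 0 <= Lambda mu W S x.
Proof.
apply: adde_ge0; last by apply: esum_ge0.
by apply: integral_ge0 => y _; rewrite lee_fin kernel_ge0.
Qed.

Lemma Lambda_le1 x : Lambda mu W S x <= 1.
Proof.
have mI := measurable_nonatomic_part mS.
rewrite -(probability_setT mu) (measure_components mu mS trivS measurableT).
apply: leeD.
  rewrite setTI -[leRHS]mul1e -integral_cst//; apply: ge0_le_integral => //.
  - by move=> y _; rewrite lee_fin kernel_ge0.
  - exact: measurable_kernel_section.
  - by move=> y _; rewrite lee_fin kernel_le1.
by rewrite esum_mkcond; apply: le_esum => i _; rewrite setTI; case: ifP.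
Qed.

Lemma measurable_Lambda : measurable_fun setT (Lambda mu W S).
Proof.
apply: emeasurable_funD.
  exact/measurable_integral_kernel/measurable_nonatomic_part.
under eq_fun do rewrite esum_mkcond.
apply: ge0_emeasurable_esum => [j x|j]; first by case: ifP.
pose X := [set x | dominated_atoms mu W S x j].
rewrite (_ : (fun x => _) = (fun x => mu (S j) * (\1_X x)%:E)).
  apply: measurable_funeM; apply/measurable_EFinP/measurable_indic.
  exact: measurable_dominated.
apply/funext => x; rewrite indicE.
rewrite (_ : (x \in X) = (j \in dominated_atoms mu W S x))//.
by case: ifP; rewrite ?mule1 ?mule0.
Qed.

Lemma eta_inr_bounds x : (0 <= eta_map mu W S (inr x) <= 1)%R.
Proof.
have L0 := Lambda_ge0 x; have L1 := Lambda_le1 x.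
have Lfin : Lambda mu W S x \is a fin_num.
  by rewrite ge0_fin_numE// (le_lt_trans L1)// ltry.
rewrite /eta_map subr_ge0 gerBl fine_ge0// andbT.
by rewrite -lee_fin fineK.
Qed.

End tournament_kernels.

(** * Positions and atoms *)

Section positions.
Context {d : measure_display} {T : measurableType d} {R : realType}
  (mu : probability T R) (W : T -> T -> R)
  (tourW : tournament_kernel setT mu W)
  (pos : T -> R) (posP : position mu (cut mu W) pos).

Lemma cut_position_lt t : cut mu W [set x | pos x < t]%R.
Proof. by case: posP. Qed.

Lemma cut_position_le t : cut mu W [set x | pos x <= t]%R.
Proof. by case: posP. Qed.

Lemma measurable_position_lt t : measurable [set x | pos x < t]%R.
Proof. by case: (cut_position_lt t). Qed.

Lemma measurable_position_le t : measurable [set x | pos x <= t]%R.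
Proof. by case: (cut_position_le t). Qed.

Lemma position_levelE t :
  [set x | pos x = t] = [set x | pos x <= t]%R `\` [set x | pos x < t]%R.
Proof.
apply/seteqP; split=> [x /= ->|x /= [xt /negP]]; first by rewrite ltxx lexx.
by rewrite -leNgt => tx; apply/le_anti; rewrite xt.
Qed.

Lemma measurable_position_level t : measurable [set x | pos x = t].
Proof.
by rewrite position_levelE; apply: measurableD;
  [exact: measurable_position_le|exact: measurable_position_lt].
Qed.

Lemma measurable_position : measurable_fun setT pos.
Proof.
apply: (measurability _ (RGenInftyO.measurableE R)) => //.
move=> _ [_ [t ->] <-]; rewrite setTI (_ : _ @^-1` _ = [set x | pos x < t]%R).
  exact: measurable_position_lt.
by apply/seteqP; split=> x /=; rewrite in_itv.
Qed.

Lemma measure_position_le x : mu [set y | pos y <= pos x]%R = (pos x)%:E.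
Proof. by case: posP => _ _ + _; exact. Qed.

Lemma le_measure_position_lt x t : (pos x < t)%R ->
  (pos x <= fine (mu [set y | pos y < t]%R))%R.
Proof.
move=> xt; rewrite -lee_fin -measure_position_le fineK ?fin_num_measure//.
  apply: le_measure; rewrite ?inE.
  - exact: measurable_position_le.
  - exact: measurable_position_lt.
  - by move=> y /= yx; exact: le_lt_trans xt.
exact: measurable_position_lt.
Qed.

Lemma ae_position_lt :
  {ae mu \x mu, forall p : T * T, (pos p.1 < pos p.2)%R -> W p.1 p.2 = 1%R}.
Proof.
have : {ae mu \x mu, forall p : T * T, forall q : rat,
    (pos p.1 < ratr q)%R -> ~ (pos p.2 < ratr q)%R -> W p.1 p.2 = 1%R}.
  by apply: ae_forall_countable => q; have [_ _ _] := cut_position_lt (ratr q).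
apply: filterS => p pos_q /rat_in_itvoo[q]; rewrite in_itv/= => /andP[q1 q2].
by apply: (pos_q q) => //; apply/negP; rewrite -leNgt ltW.
Qed.

Lemma ae_position_gt :
  {ae mu \x mu, forall p : T * T, (pos p.2 < pos p.1)%R -> W p.1 p.2 = 0%R}.
Proof.
have [_ _ W_sym] := tourW.
apply: filterS2 (ae_prod_swap ae_position_lt) W_sym => p /= + W_symp /[dup] lt.
move=> /[apply] W21; have := W_symp Logic.I Logic.I.
by rewrite W21 => /eqP; rewrite -subr_eq0 addrK => /eqP.
Qed.

Lemma cut_level_zero_one t U : cut mu W U ->
  zero_one_on mu [set x | pos x = t] U.
Proof.
have [_ _ _ cut_le] := posP => /cut_le[u Uu].
have [tu|ut] := leP t u; [left|right]; apply: filterS Uu => x [xU Ux] /= xt.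
  by apply: Ux; rewrite xt.
by move/xU; rewrite xt leNgt ut.
Qed.

Lemma sigmaZ_level_zero_one t E : sigmaZ mu W E ->
  zero_one_on mu [set x | pos x = t] E.
Proof.
apply: zero_one_on_sigma => A /Zfamily_setD_cut[U [V [cutU cutV ->]]].
by apply: zero_one_onD; exact: cut_level_zero_one.
Qed.

Lemma sigmaZ_level t : sigmaZ mu W [set x | pos x = t].
Proof.
rewrite position_levelE; apply: sigmaZ_setD; apply: sigmaZ_cut.
  exact: cut_position_le.
exact: cut_position_lt.
Qed.

Lemma atom_level t : 0 < mu [set x | pos x = t] ->
  atom (sigmaZ mu W) mu [set x | pos x = t].
Proof.
move=> t0; apply: zero_one_atom => //; first exact: sigmaZ_measurable.
  exact: sigmaZ_level.
by move=> E; exact: sigmaZ_level_zero_one.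
Qed.

Lemma atom_ae_level A : atom (sigmaZ mu W) mu A ->
  exists t, {ae mu, forall x, A x <-> pos x = t}.
Proof.
move=> atomA; have [sA A0 _] := atomA; have mA := sigmaZ_measurable sA.
have [t|t At] := zero_one_on_ae_constant (m := mu) (A := A) (f := pos).
  apply: (atom_zero_one _ atomA); first exact: sigmaZ_measurable.
  by apply: sigmaZ_setI => //; apply: sigmaZ_cut; exact: cut_position_lt.
exists t; have [tA|tA] := sigmaZ_level_zero_one t sA.
  by apply: filterS2 At tA => x; split.
have [x Ax [xt nAx]] := ae_exists mA A0 (filterI At tA).
by exfalso; exact: nAx (xt Ax) Ax.
Qed.

Context {Q : countType} (S : Q -> set T)
  (atomsS : atom_enumeration (sigmaZ mu W) mu S).

Lemma measurable_atom i : measurable (S i).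
Proof. by have [/(_ i)[/sigmaZ_measurable]] := atomsS. Qed.

Lemma trivIset_atom : trivIset setT S.
Proof. by case: atomsS. Qed.

Lemma atom_gt0 i : 0 < mu (S i).
Proof. by have [/(_ i)[]] := atomsS. Qed.

Lemma fine_atom_gt0 i : (0 < fine (mu (S i)))%R.
Proof.
rewrite fine_gt0// atom_gt0 ltey_eq fin_num_measure//.
exact: measurable_atom.
Qed.

Let mS := measurable_atom.
Let trivS := trivIset_atom.
Let mI := measurable_nonatomic_part mS.
Let mlevel := measurable_position_level.

Lemma ae_nonatomic_neq t :
  {ae mu, forall x, nonatomic_part S x -> pos x <> t}.
Proof.
have [t0|t0] := eqVneq (mu [set x | pos x = t]) 0.
  by apply: filterS ((ae_notinP mu (mlevel t)).2 t0) => x nt _.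
have [_ _ /(_ [set x | pos x = t])[|i]] := atomsS.
  by apply: atom_level; rewrite lt0e t0 measure_ge0.
have mLS := measurableD (mlevel t) (mS i).
have mSL := measurableD (mS i) (mlevel t).
move=> /(ae_notinP mu (measurableU _ _ mLS mSL)).
apply: filterS => x nLS Ix xt; apply: nLS; left; split=> //.
exact: nonatomic_partN.
Qed.

Lemma ae_nonatomic_pair_neq : {ae mu \x mu, forall p : T * T,
  nonatomic_part S p.2 -> pos p.1 <> pos p.2}.
Proof.
have mpos := measurable_position.
by apply: ae_prod_neq => // t; exact: ae_nonatomic_neq.
Qed.

Lemma nonatomic_nonatomic_part (G : set (set T)) (nu : probability T R) :
  nu `<< mu -> G `<=` measurable ->
  (forall A E, G A -> sigmaZ mu W E -> G (A `&` E)) ->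
  nonatomic G (nonatomic_part S) nu.
Proof.
move=> nu_mu mG GI; apply: (nonatomic_null_levels mG (f := pos)) => [A t GA|t].
  by apply: GI => //; apply: sigmaZ_cut; exact: cut_position_lt.
exact: (null_dominates_ae nu_mu (ae_nonatomic_neq t)).
Qed.

Lemma nonatomic_part_cond_prob (muI := cond_prob mu (nonatomic_part S)) :
  0 < mu (nonatomic_part S) ->
  [/\ forall A, measurable A ->
        muI A = mu (A `&` nonatomic_part S) / mu (nonatomic_part S),
      nonatomic measurable (nonatomic_part S) muI &
      nonatomic (sigmaZ mu W) (nonatomic_part S) muI].
Proof.
move=> I0; have muI_mu : muI `<< mu by exact: cond_prob_dominated.
split; first by move=> A mA; exact: cond_probE.
- apply: nonatomic_nonatomic_part => // A E mA /sigmaZ_measurable.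
  exact: measurableI.
- apply: nonatomic_nonatomic_part => //; first exact: sigmaZ_measurable.
  exact: sigmaZ_setI.
Qed.

Lemma transitive_nonatomic_part (nu : probability T R) A :
  nu `<< mu -> A `<=` nonatomic_part S -> transitive_kernel A nu W.
Proof.
move=> nu_mu AI; have nu_mu2 := null_dominates_prod nu_mu nu_mu.
have ae_lt : {ae nu \x nu, forall p : T * T, A p.2 ->
    (0 < W p.1 p.2)%R -> (pos p.1 < pos p.2)%R}.
  apply: (null_dominates_ae nu_mu2).
  apply: filterS2 ae_position_gt ae_nonatomic_pair_neq.
  move=> p W0 p_neq /AI /p_neq neq.
  by have [//|/W0 ->|//] := ltgtP (pos p.1) (pos p.2); rewrite ltxx.
have ae_W1 := null_dominates_ae nu_mu2 ae_position_lt.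
have ae12 := ae_prod_fst nu ae_lt.
have ae23 := ae_prod_comp_fst measurable_snd
  (@ae_prod_snd _ _ _ _ _ nu nu) ae_lt.
have ae13 := ae_prod_comp_fst measurable_fst
  (@ae_prod_fst _ _ _ _ _ nu nu) ae_W1.
apply: filterS3 ae12 ae23 ae13 => -[[x y] z] /= xy yz xz Ax Ay Az Wxy Wyz.
by apply: xz; exact: lt_trans (xy Ay Wxy) (yz Az Wyz).
Qed.

Lemma exists_atom_levels : exists lev : Q -> R,
  {ae mu, forall x, forall i, S i x <-> pos x = lev i}.
Proof.
have [atomS _ _] := atomsS.
have [lev levP] := choice (fun i => atom_ae_level (atomS i)).
by exists lev; apply: ae_forall_countable.
Qed.

Context (lev : Q -> R)
  (levP : {ae mu, forall x, forall i, S i x <-> pos x = lev i}).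

Lemma atom_level_attained i : exists2 x, S i x & pos x = lev i.
Proof.
have [x Six xlev] := ae_exists (mS i) (atom_gt0 i) levP.
by exists x => //; apply/xlev.
Qed.

Lemma atom_level_inj : injective lev.
Proof.
move=> i j ij.
have [x Six xS] := ae_exists (mS i) (atom_gt0 i) levP.
by apply: (component_inj trivS Six); apply/xS; rewrite -ij; apply/xS.
Qed.

Lemma measure_level i : mu [set x | pos x = lev i] = mu (S i).
Proof.
apply: eq_measure_ae => //.
by apply: filterS levP => x /(_ i)[]; split.
Qed.

Lemma fine_measure_lt_level i :
  (fine (mu [set x | pos x < lev i]%R) + fine (mu (S i)) = lev i)%R.
Proof.
have mle := measurable_position_le; have mlt := measurable_position_lt.
have [x _ xlev] := atom_level_attained i.
have leE : mu [set y | pos y <= lev i]%R =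
    mu [set y | pos y < lev i]%R + mu (S i).
  rewrite -measure_level position_levelE addeC.
  rewrite [LHS](measureDI mu (mle _) (mlt (lev i))) setIidr//.
  by move=> y /ltW.
by rewrite -fineD ?fin_num_measure// -leE -xlev measure_position_le.
Qed.

Lemma ae_component_neq : {ae mu \x mu, forall p : T * T,
  ~ (exists i, S i p.1 /\ S i p.2) -> pos p.1 <> pos p.2}.
Proof.
apply: filterS3 ae_nonatomic_pair_neq (ae_prod_swap ae_nonatomic_pair_neq)
  (ae_prod_and levP levP) => -[x y] /= xIy yIx [xS yS] nxy xy.
have [/yIx|[i Six]] := nonatomic_part_or S x; first by apply.
apply: nxy; exists i; split=> //; apply/yS; rewrite -xy; exact/xS.
Qed.

Lemma cut_lt_levelU i B : measurable B -> B `<=` S i ->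
  beats mu W B (S i `\` B) -> cut mu W ([set x | pos x < lev i]%R `|` B).
Proof.
rewrite /beats => mB BS WB; apply/cutP; split.
  by apply: measurableU => //; exact: measurable_position_lt.
apply: filterS3 WB ae_position_lt (ae_prod_and levP levP).
move=> p WBp W1 [xS yS] Ux nUy.
have : (lev i <= pos p.2)%R by rewrite leNgt; apply/negP => ?; apply: nUy; left.
case: Ux => [x_lt /(lt_le_trans x_lt)/W1//|Bx].
have x_lev := (xS i).1 (BS _ Bx).
rewrite le_eqVlt => /orP[/eqP y_lev|]; last by rewrite -x_lev => /W1.
apply: WBp => //; split; first exact/yS.
by move=> By; apply: nUy; right.
Qed.

Lemma irreducible_atom i : irreducible_kernel (S i) (cond_prob mu (S i)) W.
Proof.
move=> [B [mB BS /andP[B0 B1] [_ _ _ WB]]].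
have Si0 := atom_gt0 i; have [/(_ i) atomSi _ _] := atomsS.
have {}WB : beats mu W B (S i `\` B).
  apply: filterS (ae_prod_cond_prob (mS i) Si0 WB) => p WBp Bp SBp.
  by apply: WBp => //; [exact: BS|case: SBp].
have cutU := cut_lt_levelU mB BS WB.
have [sSi _ _] := atomSi.
have mBS := measurableI _ _ mB (mS i).
have := atom_zero_one (@sigmaZ_measurable _ _ _ mu W) atomSi
  (sigmaZ_setI sSi (sigmaZ_cut cutU)).
move: B0 B1; rewrite cond_probE// => B0 B1 [] SU.
- suff muBS : mu (B `&` S i) = mu (S i).
    by move: B1; rewrite muBS divee ?ltxx ?fin_num_measure ?gt_eqF.
  apply: eq_measure_ae => //; apply: filterS2 SU levP => x SUx xS.
  split=> [[]//|Six]; split=> //.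
  by case: (SUx Six) => //=; rewrite ((xS i).1 Six) ltxx.
- suff muBS : mu (B `&` S i) = 0 by move: B0; rewrite muBS mul0e ltxx.
  apply/ae_notinP => //; apply: filterS SU => x SUx [Bx /SUx]; apply.
  by right.
Qed.

(** * The map eta *)

Local Notation eta := (eta_map mu W S).

Let measurable_gt t : measurable [set x | t < pos x]%R.
Proof.
rewrite (_ : [set x | _] = ~` [set x | pos x <= t]%R).
  exact/measurableC/measurable_position_le.
by apply/seteqP; split=> x /=; rewrite ltNge => /negP.
Qed.

Lemma ae_section_kernel : {ae mu, forall x, {ae mu, forall y,
  ((pos x < pos y)%R -> W x y = 1%R) /\ ((pos y < pos x)%R -> W x y = 0%R)}}.
Proof.
have : {ae mu \x mu, forall p : T * T,
    ((pos p.1 < pos p.2)%R -> W p.1 p.2 = 1%R) /\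
    ((pos p.2 < pos p.1)%R -> W p.1 p.2 = 0%R)}.
  by apply: filterS2 ae_position_lt ae_position_gt => p; split.
exact: ae_prod_xsection.
Qed.

Lemma ae_dominated_atoms :
  {ae mu, forall x, dominated_atoms mu W S x = [set j | pos x < lev j]%R}.
Proof.
apply: filterS3 levP ae_section_kernel (ae_not_dominated_self tourW mS).
move=> x xS xW xself; apply/seteqP; split=> j /= => [xj|x_lt].
  rewrite ltNge le_eqVlt; apply/negP => /orP[/eqP jx|jx].
    by apply: (xself j) => //; apply/xS.
  have [y Sjy [yS [[_ W0] W1]]] := ae_exists (mS j) (atom_gt0 j)
    (filterI levP (filterI xW xj)).
  have := W1 Sjy; rewrite W0; last by rewrite ((yS j).1 Sjy).
  by move/eqP; rewrite eq_sym oner_eq0.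
apply: filterS2 xW levP => y [W1 _] yS Sjy.
by apply: W1; rewrite ((yS j).1 Sjy).
Qed.

Lemma ae_integral_kernel : {ae mu, forall x,
  \int[mu]_(y in nonatomic_part S) (W x y)%:E =
  mu ([set y | pos x < pos y]%R `&` nonatomic_part S)}.
Proof.
apply: filterS ae_section_kernel => x xW.
rewrite -integral_indic//; apply: ge0_ae_eq_integral => //.
- exact: (measurable_kernel_section tourW).
- by apply/measurable_EFinP; exact: measurable_indic.
- by move=> y _; rewrite lee_fin (kernel_ge0 tourW).
apply: filterS2 xW (ae_nonatomic_neq (pos x)).
move=> y [W1 W0] y_neq Iy; rewrite indicE.
have [xy|yx|/esym/(y_neq Iy)//] := ltgtP (pos x) (pos y).
  by rewrite W1// mem_set.
by rewrite W0// memNset//= ltNge ltW.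
Qed.

Lemma esum_atoms_gt t : \esum_(j in [set j | t < lev j]%R) mu (S j) =
  \esum_(j in [set: Q]) mu ([set y | t < pos y]%R `&` S j).
Proof.
rewrite esum_mkcond; apply: eq_esum => j _; apply/esym.
have mtS := measurableI _ _ (measurable_gt t) (mS j).
case: ifPn => [/set_mem /= tj|/negP tj].
  apply: eq_measure_ae => //; apply: filterS levP => y yS.
  by split=> [[]//|Sjy]; split=> //=; rewrite ((yS j).1 Sjy).
apply/ae_notinP => //; apply: filterS levP => y yS [/= ty Sjy].
by apply/tj/mem_set; rewrite /= -((yS j).1 Sjy).
Qed.

Lemma ae_Lambda : {ae mu, forall x, Lambda mu W S x = (1 - pos x)%:E}.
Proof.
apply: filterS2 ae_dominated_atoms ae_integral_kernel => x xdom xint.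
rewrite /Lambda xdom xint esum_atoms_gt -measure_components//.
rewrite (_ : [set y | _] = ~` [set y | pos y <= pos x]%R).
  rewrite probability_setC; last exact: measurable_position_le.
  by rewrite measure_position_le.
by apply/seteqP; split=> y /=; rewrite ltNge => /negP.
Qed.

Lemma ae_eta_inr : {ae mu, forall x, eta (inr x) = pos x}.
Proof.
by apply: filterS ae_Lambda => x; rewrite /eta_map => -> /=; rewrite subKr.
Qed.

Lemma eta_inl i : eta (inl i) = fine (mu [set x | pos x < lev i]%R).
Proof.
rewrite /eta_map (_ : \int[mu]_(x in S i) _ = (1 - lev i)%:E * mu (S i)).
  have lt_level := fine_measure_lt_level i.
  have Si0 : (fine (mu (S i)) != 0)%R by rewrite gt_eqF// fine_atom_gt0.
  by rewrite fineM ?fin_num_measure//= mulrCA mulVf//; lra.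
rewrite -integral_cst//; apply: ae_eq_integral => //.
  exact/measurable_funTS/(measurable_Lambda tourW).
by apply: filterS2 ae_Lambda levP => x -> xS Six; rewrite ((xS i).1 Six).
Qed.

Lemma eta_inl_bounds i : (0 <= eta (inl i) <= 1)%R.
Proof.
have mlt := measurable_position_lt (lev i).
rewrite eta_inl fine_ge0//= -lee_fin fineK ?fin_num_measure//.
exact: probability_le1.
Qed.

Lemma eta_inlD i : (eta (inl i) + fine (mu (S i)) = lev i)%R.
Proof. by rewrite eta_inl fine_measure_lt_level. Qed.

Lemma eta_inl_lt_level i : (eta (inl i) < lev i)%R.
Proof. by rewrite -eta_inlD ltrDl fine_atom_gt0. Qed.

Lemma position_le_eta_inl x i : (pos x < lev i)%R -> (pos x <= eta (inl i))%R.
Proof. by rewrite eta_inl; exact: le_measure_position_lt. Qed.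

Lemma eta_inl_homo i j : (lev i < lev j)%R -> (eta (inl i) < eta (inl j))%R.
Proof.
have [x _ x_lev] := atom_level_attained i.
move=> ij; apply: lt_le_trans (eta_inl_lt_level i) _.
by rewrite -x_lev; apply: position_le_eta_inl; rewrite x_lev.
Qed.

Lemma eta_inl_inj : injective (fun i => eta (inl i)).
Proof.
move=> i j etaij; apply: atom_level_inj.
by have [/eta_inl_homo|/eta_inl_homo|//] := ltgtP (lev i) (lev j);
  rewrite etaij ltxx.
Qed.

Lemma ae_eta_inr_support : {ae mu, forall x, nonatomic_part S x ->
  (0 <= eta (inr x) <= 1)%R /\
  forall i, ~ (eta (inl i) <= eta (inr x)
                 < eta (inl i) + fine (mu (S i)))%R}.
Proof.
have ae_neq : {ae mu, forall x, forall i, nonatomic_part S x ->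
    pos x <> eta (inl i)}.
  by apply: ae_forall_countable => i; exact: ae_nonatomic_neq.
apply: filterS2 ae_eta_inr ae_neq => x etax x_neq Ix.
split=> [|i]; first exact: (eta_inr_bounds tourW).
rewrite etax eta_inlD => /andP[eta_le /position_le_eta_inl le_eta].
by apply: (x_neq i Ix); apply/le_anti; rewrite le_eta.
Qed.

Lemma ae_eta_inr_inj : {ae mu \x mu, forall p : T * T,
  nonatomic_part S p.1 -> nonatomic_part S p.2 ->
  eta (inr p.1) = eta (inr p.2) -> p.1 = p.2}.
Proof.
apply: filterS2 ae_nonatomic_pair_neq (ae_prod_and ae_eta_inr ae_eta_inr).
by move=> p p_neq [-> ->] _ I2 /(p_neq I2).
Qed.

Lemma ae_dsum_eta_lt : {ae mu \x mu, forall p : T * T, (pos p.1 < pos p.2)%R ->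
  (dsum_eta S eta p.1 < dsum_eta S eta p.2)%R}.
Proof.
apply: filterS3 (ae_prod_and levP levP) (ae_prod_and ae_eta_inr ae_eta_inr)
  (ae_prod_fst mu ae_eta_inr_support) => p [xS yS] [etax etay] x_supp xy.
have [Ix|[i Six]] := nonatomic_part_or S p.1;
  have [Iy|[j Sjy]] := nonatomic_part_or S p.2.
- by rewrite !dsum_eta_nonatomic// etax etay.
- rewrite (dsum_eta_nonatomic _ Ix) (dsum_eta_component trivS _ Sjy).
  rewrite ltNge; apply/negP => le_eta; have [_ /(_ j)] := x_supp Ix; apply.
  by rewrite le_eta eta_inlD etax -((yS j).1 Sjy).
- rewrite (dsum_eta_component trivS _ Six) (dsum_eta_nonatomic _ Iy) etay.
  by apply: lt_trans (eta_inl_lt_level i) _; rewrite -((xS i).1 Six).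
- rewrite (dsum_eta_component trivS _ Six) (dsum_eta_component trivS _ Sjy).
  by apply: eta_inl_homo; rewrite -((xS i).1 Six) -((yS j).1 Sjy).
Qed.

Lemma ae_kernel_dsum : {ae mu \x mu, forall p : T * T,
  W p.1 p.2 = dsum_kernel S (fun=> W) eta p.1 p.2}.
Proof.
pose summand_eta := dsum_eta S eta.
have ae_lt : {ae mu \x mu, forall p : T * T, (pos p.1 < pos p.2)%R ->
    W p.1 p.2 = 1%R /\ (summand_eta p.1 < summand_eta p.2)%R}.
  apply: filterS2 ae_position_lt ae_dsum_eta_lt => p W1 eta_lt xy.
  by split; [exact: W1|exact: eta_lt].
have ae_gt : {ae mu \x mu, forall p : T * T, (pos p.2 < pos p.1)%R ->
    W p.1 p.2 = 0%R /\ (summand_eta p.2 < summand_eta p.1)%R}.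
  apply: filterS2 ae_position_gt (ae_prod_swap ae_dsum_eta_lt).
  by move=> p W0 eta_gt yx; split; [exact: W0|exact: eta_gt].
apply: filterS3 ae_component_neq ae_lt ae_gt.
move=> [x y] /= xy_neq lt gt.
rewrite /dsum_kernel -/summand_eta; case: pselect => [//|/xy_neq neq].
have [/lt[-> ->]//|/gt[-> yx]|//] := ltgtP (pos x) (pos y).
by rewrite ltNge ltW//= yx.
Qed.

End positions.

Theorem theorem6p11 (d : measure_display) (T : measurableType d) (R : realType)
    (mu : probability T R) (W : T -> T -> R)
    (hW : tournament_kernel [set: T] mu W)
    (Q : countType) (S : Q -> set T)
    (hS : atom_enumeration (sigmaZ mu W) mu S) :
  let I := nonatomic_part S in
  let eta := eta_map mu W S in
  let mu_ := fun i : Q => cond_prob mu (S i) in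
  let muI := cond_prob mu I in
  (* S is the disjoint union of I and the S_i *)
  [/\ trivIset [set: Q] S, forall i, I `&` S i = set0 &
      [set: T] = I `|` \bigcup_i S i] /\
  (* decomposition of mu *)
  (forall A, measurable A ->
     mu A = dsum_measure (fun i => mu (S i)) mu_ muI A) /\
  (* W is the direct sum, with eta taking its values in [0, 1] *)
  [/\ forall i, (0 <= eta (inl i) <= 1)%R,
      forall x, I x -> (0 <= eta (inr x) <= 1)%R &
      {ae mu \x mu, forall p : T * T,
         W p.1 p.2 = dsum_kernel S (fun=> W) eta p.1 p.2}] /\
  (* (i) *)
  (forall i, 0 < mu (S i)) /\
  (* (ii) *)
  (forall i A, measurable A -> mu_ i A = mu (A `&` S i) / mu (S i)) /\
  (* (iii) *)
  (0 < mu I ->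
     [/\ forall A, measurable A -> muI A = mu (A `&` I) / mu I,
         nonatomic measurable I muI & nonatomic (sigmaZ mu W) I muI]) /\
  (* (iv) *)
  [/\ injective (fun i => eta (inl i)),
      {ae muI \x muI, forall p : T * T, I p.1 -> I p.2 ->
         eta (inr p.1) = eta (inr p.2) -> p.1 = p.2} &
      {ae muI, forall x, I x ->
         (0 <= eta (inr x) <= 1)%R /\
         forall i, ~ (eta (inl i) <= eta (inr x)
                        < eta (inl i) + fine (mu (S i)))%R}] /\
  (* (v) *)
  (forall i, tournament_kernel (S i) (mu_ i) W
             /\ irreducible_kernel (S i) (mu_ i) W) /\
  (* (vi) *)
  (forall A, measurable A -> A `<=` I -> 0 < muI A ->
     transitive_kernel A (cond_prob muI A) W).
Proof.
move=> I eta mu_ muI.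
have [pos posP] := exists_position (essential_chain_cut hW).
have [lev levP] := exists_atom_levels posP hS.
have [mS trivS] := (measurable_atom hS, trivIset_atom hS).
have muI_mu : muI `<< mu by exact: cond_prob_dominated.
have muI2_mu2 := null_dominates_prod muI_mu muI_mu.
split; first exact: nonatomic_part_partition.
split; first by move=> A mA; exact: dsum_measureE.
split; first split=> [i|x _|].
- exact: (eta_inl_bounds hW posP hS levP).
- exact: (eta_inr_bounds hW mS trivS).
- exact: (ae_kernel_dsum hW posP hS levP).
split; first exact: (atom_gt0 hS).
split; first by move=> i A mA; apply: cond_probE => //; exact: (atom_gt0 hS).
split; first by exact: (nonatomic_part_cond_prob posP hS).
split; first split.
- exact: (eta_inl_inj hW posP hS levP).
- exact: null_dominates_ae muI2_mu2 (ae_eta_inr_inj hW posP hS levP).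
- exact: null_dominates_ae muI_mu (ae_eta_inr_support hW posP hS levP).
split=> [i|A mA AI _]; first split.
- exact/(tournament_restriction hW)/cond_prob_dominated.
- exact: (irreducible_atom posP hS levP).
- apply: (transitive_nonatomic_part hW posP hS) AI.
  exact: null_dominates_trans (@cond_prob_dominated _ _ _ muI A) muI_mu.
Qed.
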